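(* Let $k$ be a field and let $X\subset \mathbf{P}^3_k$ be a smooth cubic surface over $k$ containing a line $L$ defined over $k$. Let $f : X \to \mathbf{P}^1_k$ be the conic fibration defined by the family of $2$-planes containing $L$. Then $f$ has a section (over $k$) if and only if there exists a line $L' \subset X$ defined over $k$ which does not meet $L$. Moreover, every such line $L'$ is a section of $f$.
   Context: The planes of $\mathbf{P}^3_k$ containing $L$ are parametrized by a $\mathbf{P}^1_k$. For each such plane $\Pi$, one has $\Pi \cap X = L \cup C_\Pi$ with $C_\Pi$ a residual conic (as divisors on $X$, $\Pi\cap X = L + C_\Pi$), and the conics $C_\Pi$ are the fibres of a morphism $f: X \to \mathbf{P}^1_k$; this is the conic fibration defined by $L$. A curve $L'\subset X$ is called a section of $f$ if $f$ restricts to an isomorphism $L' \to \mathbf{P}^1_k$, equivalently if it is the image of a $k$-morphism $s: \mathbf{P}^1_k\to X$ with $f\circ s = \mathrm{id}$. *)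

(* Defs.v *)
From HB Require Import structures.
From mathcomp Require Import all_boot all_order all_algebra.
From mathcomp Require Import mpoly.

Set Implicit Arguments.
Unset Strict Implicit.
Unset Printing Implicit Defensive.

Import GRing.Theory.
Local Open Scope ring_scope.

(* Conventions.  A point of P^n(K) is given by a nonzero row vector
   x : 'rV[K]_n.+1, up to scaling; (x == y)%MS says that two nonzero row vectors
   represent the same point.  A line of P^3 defined over k is the row space of a
   2 x 4 matrix of rank 2.  Geometric conditions (smoothness, inclusion, absence
   of common points, equality of morphisms) are tested on K-points for every
   field extension iota : k -> K; testing them on k-points only would be wrong,
   for instance over a finite field. *)

Definition on_surface (K : fieldType) (F : {mpoly K[4]}) (x : 'rV[K]_4) : Prop :=
  F.@[x 0] = 0.

Definition is_cubic_form (k : fieldType) (F : {mpoly k[4]}) : Prop :=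
  F != 0 /\ F \is 3.-homog.

(* The Jacobian criterion at all points over all field extensions.  The condition
   F(x) = 0 is kept because Euler's relation does not recover it in
   characteristic 3. *)
Definition smooth_surface (k : fieldType) (F : {mpoly k[4]}) : Prop :=
  forall (K : fieldType) (iota : {rmorphism k -> K}) (x : 'rV[K]_4),
    x != 0 -> on_surface (map_mpoly iota F) x ->
    exists i : 'I_4, ((map_mpoly iota F)^`M(i)).@[x 0] != 0.

Definition is_line (k : fieldType) (L : 'M[k]_(2, 4)) : Prop := \rank L = 2%N.

Definition line_in_surface (k : fieldType) (L : 'M[k]_(2, 4))
    (F : {mpoly k[4]}) : Prop :=
  forall (K : fieldType) (iota : {rmorphism k -> K}) (x : 'rV[K]_4),
    (x <= map_mx iota L)%MS -> on_surface (map_mpoly iota F) x.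

Definition lines_meet (k : fieldType) (L L' : 'M[k]_(2, 4)) : Prop :=
  exists (K : fieldType) (iota : {rmorphism k -> K}) (x : 'rV[K]_4),
    [/\ x != 0, (x <= map_mx iota L)%MS & (x <= map_mx iota L')%MS].

(* The columns of N are a basis of the linear forms vanishing on L, i.e. N is a
   choice of coordinates on the P^1 of planes containing L. *)
Definition is_pencil (k : fieldType) (L : 'M[k]_(2, 4)) (N : 'M[k]_(4, 2)) : Prop :=
  \rank N = 2%N /\ L *m N = 0.

Definition pencil_form (K : fieldType) (N : 'M[K]_(4, 2)) (j : 'I_2) : {mpoly K[4]} :=
  \sum_(i < 4) N i j *: 'X_i.

(* The equation of the plane with parameter (t_0 : t_1); it is normalised so that
   a point x outside L lies on the plane with parameter (l_0(x) : l_1(x)), where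
   l_j := pencil_form N j. *)
Definition plane_form (K : fieldType) (N : 'M[K]_(4, 2)) (t : 'rV[K]_2) :
    {mpoly K[4]} :=
  t 0 0 *: pencil_form N 1 - t 0 1 *: pencil_form N 0.

(* {l = q = 0} is the residual conic of L in the intersection of {F = 0} with the
   plane {l = 0}: modulo l one has F = m * q, where {l = m = 0} is L. *)
Definition is_residual_conic (K : fieldType) (F : {mpoly K[4]})
    (L : 'M[K]_(2, 4)) (l q : {mpoly K[4]}) : Prop :=
  q \is 2.-homog /\
  exists m r : {mpoly K[4]},
    [/\ m \is 1.-homog, r \is 2.-homog,
        forall x : 'rV[K]_4, (x <= L)%MS <-> (l.@[x 0] = 0 /\ m.@[x 0] = 0)
      & F = m * q + l * r].

Definition on_conic (K : fieldType) (F : {mpoly K[4]}) (L : 'M[K]_(2, 4))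
    (N : 'M[K]_(4, 2)) (t : 'rV[K]_2) (x : 'rV[K]_4) : Prop :=
  (plane_form N t).@[x 0] = 0 /\
  exists2 q : {mpoly K[4]}, is_residual_conic F L (plane_form N t) q & q.@[x 0] = 0.

(* The graph of f on K-points: the conics are the fibres of f, so f(x) = t means
   that x lies on the conic with parameter t.  This also covers the points of L. *)
Definition fibration_graph (K : fieldType) (F : {mpoly K[4]}) (L : 'M[K]_(2, 4))
    (N : 'M[K]_(4, 2)) (x : 'rV[K]_4) (t : 'rV[K]_2) : Prop :=
  [/\ x != 0, t != 0, on_surface F x & on_conic F L N t x].

(* A map from P^1 to P^3 is given by four binary forms. *)
Definition eval_map (K : fieldType) (s : 'I_4 -> {mpoly K[2]}) (t : 'rV[K]_2) :
    'rV[K]_4 :=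
  \row_(i < 4) (s i).@[t 0].

Definition base_change (k K : fieldType) (iota : {rmorphism k -> K})
    (s : 'I_4 -> {mpoly k[2]}) : 'I_4 -> {mpoly K[2]} :=
  fun i => map_mpoly iota (s i).

Definition is_morphism_to_surface (k : fieldType) (F : {mpoly k[4]})
    (s : 'I_4 -> {mpoly k[2]}) : Prop :=
  (exists d : nat, forall i, s i \is d.-homog) /\
  forall (K : fieldType) (iota : {rmorphism k -> K}) (t : 'rV[K]_2), t != 0 ->
    eval_map (base_change iota s) t != 0 /\
    on_surface (map_mpoly iota F) (eval_map (base_change iota s) t).

Definition is_section (k : fieldType) (F : {mpoly k[4]}) (L : 'M[k]_(2, 4))
    (N : 'M[k]_(4, 2)) (s : 'I_4 -> {mpoly k[2]}) : Prop :=
  is_morphism_to_surface F s /\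
  forall (K : fieldType) (iota : {rmorphism k -> K}) (t : 'rV[K]_2), t != 0 ->
    fibration_graph (map_mpoly iota F) (map_mx iota L) (map_mx iota N)
      (eval_map (base_change iota s) t) t.

Definition line_is_image (k : fieldType) (L' : 'M[k]_(2, 4))
    (s : 'I_4 -> {mpoly k[2]}) : Prop :=
  forall (K : fieldType) (iota : {rmorphism k -> K}) (x : 'rV[K]_4), x != 0 ->
    (x <= map_mx iota L')%MS <->
    (exists2 t : 'rV[K]_2, t != 0 & (x == eval_map (base_change iota s) t)%MS).

Definition line_is_section (k : fieldType) (F : {mpoly k[4]}) (L : 'M[k]_(2, 4))
    (N : 'M[k]_(4, 2)) (L' : 'M[k]_(2, 4)) : Prop :=
  exists2 s : 'I_4 -> {mpoly k[2]}, is_section F L N s & line_is_image L' s.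

(* Main.v *)
Require Import Defs.
From HB Require Import structures.
From mathcomp Require Import all_boot all_order all_algebra all_field.
From mathcomp Require Import mpoly ring zify.

Set Implicit Arguments.
Unset Strict Implicit.
Unset Printing Implicit Defensive.

Import GRing.Theory.
Local Open Scope ring_scope.

(* Write F(x L0 + y L1 + z W) = z Q(x, y, z), where W = t M0 + M1 runs over the planes
   through L: over k[t], Q is a ternary quadratic form with coefficients of degrees
   (1, 1, 1, 2, 2, 3), and its isotropic vectors give the sections of f.  A line skew to L
   is an isotropic vector whose coordinates have degrees (<= 1, <= 1, 0).  Given a section v,
   of degrees (<= d, <= d, <= d - 1), join it to other points of the conics: a dual vector p of
   degrees (<= m, <= m, <= m + 1) with p.v = 0 exists as soon as d < 2m + 3 by counting
   coefficients, and the second intersection v' of the line p with the conic satisfies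
   (v.e)(v'.e) = Q(p x e) for all e, so its degree is at most 2m + 3 - d.  Hence d becomes 1 in one
   step if d is even, and 2, then at most 1, if d is odd.  Smoothness of X along L implies
   that the restriction of Q to z = 0 is anisotropic, which excludes v' = 0 and
   gives z <> 0 for the final vector. *)

(** * Second intersection of a line with a conic *)

Definition qform (R : comNzRingType) (A B C D E G x y z : R) : R :=
  A * x ^+ 2 + B * (x * y) + C * y ^+ 2 + D * (x * z) + E * (y * z) + G * z ^+ 2.

(* The line with dual coordinates (p, q, r) meets the conic in v = (x, y, z) and
   in a second point v'.  The cross product with (p, q, r) sends a covector e to a
   point of this line, and (v.e)(v'.e) is the value of the form there; the six
   equations are the coefficients of this identity in e. *)
Lemma second_intersection (R : comNzRingType) (A B C D E G x y z a b c p q r : R) :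
  qform A B C D E G x y z = 0 -> a * x + b * y + c * z = 1 ->
  p * x + q * y + r * z = 0 ->
  exists x' y' z' : R, qform A B C D E G x' y' z' = 0 /\
  [/\ x * x' = C * r ^+ 2 - E * (r * q) + G * q ^+ 2,
      y * y' = A * r ^+ 2 - D * (r * p) + G * p ^+ 2 &
      z * z' = A * q ^+ 2 - B * (q * p) + C * p ^+ 2] /\
  [/\ x * y' + y * x' = - B * r ^+ 2 + D * (r * q) + E * (r * p) - G * (p * q) *+ 2,
      x * z' + z * x' = B * (r * q) - C * (r * p) *+ 2 - D * q ^+ 2 + E * (q * p) &
      y * z' + z * y' = - A * (r * q) *+ 2 + B * (r * p) + D * (p * q) - E * p ^+ 2].
Proof.
move=> Hv Hbez Hp.
(* The cross product [(u, v, w)] of [(p, q, r)] and [(a, b, c)] is a point of the line; by [Hbez]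
   and [Hp], [(p, q, r)] is the cross product of [(x, y, z)] and [(u, v, w)]. *)
pose u := q * c - r * b; pose v := r * a - p * c; pose w := p * b - q * a.
have cross1 : p = y * w - z * v.
  have -> : y * w - z * v = p * (a * x + b * y + c * z) - a * (p * x + q * y + r * z).
    by rewrite /u /v /w; ring.
  by rewrite Hbez Hp; ring.
have cross2 : q = z * u - x * w.
  have -> : z * u - x * w = q * (a * x + b * y + c * z) - b * (p * x + q * y + r * z).
    by rewrite /u /v /w; ring.
  by rewrite Hbez Hp; ring.
have cross3 : r = x * v - y * u.
  have -> : x * v - y * u = r * (a * x + b * y + c * z) - c * (p * x + q * y + r * z).
    by rewrite /u /v /w; ring.
  by rewrite Hbez Hp; ring.
clearbody u v w; rewrite {}cross1 {}cross2 {}cross3 {Hbez Hp}.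
pose Qw := qform A B C D E G u v w.
pose Bvw := A * (x * u) *+ 2 + B * (x * v + y * u) + C * (y * v) *+ 2
  + D * (x * w + z * u) + E * (y * w + z * v) + G * (z * w) *+ 2.
have E0 e e' : e - e' * qform A B C D E G x y z = e by rewrite Hv mulr0 subr0.
(* At [s (x, y, z) + e (u, v, w)] the form equals [e (s Bvw + e Qw)], whose second zero is [s = Qw],
   [e = - Bvw]. The identities hold up to the multiples of the form at [(x, y, z)] passed to
   [E0]. *)
exists (Qw * x - Bvw * u), (Qw * y - Bvw * v), (Qw * z - Bvw * w).
split; [|split; split].
- by rewrite -[LHS](E0 _ (Qw ^+ 2)) /Qw /Bvw /qform; ring.
- by rewrite -[RHS](E0 _ (u ^+ 2)) /Qw /Bvw /qform; ring.
- by rewrite -[RHS](E0 _ (v ^+ 2)) /Qw /Bvw /qform; ring.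
- by rewrite -[RHS](E0 _ (w ^+ 2)) /Qw /Bvw /qform; ring.
- by rewrite -[RHS](E0 _ (u * v *+ 2)) /Qw /Bvw /qform; ring.
- by rewrite -[RHS](E0 _ (u * w *+ 2)) /Qw /Bvw /qform; ring.
- by rewrite -[RHS](E0 _ (v * w *+ 2)) /Qw /Bvw /qform; ring.
Qed.

(** * Primitive triples and syzygies over [k[t]] *)

Lemma linear_kernel_neq0 (k : fieldType) (m n : nat) (f : 'rV[k]_m -> 'rV[k]_n) :
  linear f -> (n < m)%N -> exists2 u, u != 0 & f u = 0.
Proof.
move=> f_lin lt_nm.
pose fL : {linear 'rV[k]_m -> 'rV[k]_n} :=
  HB.pack f (GRing.isLinear.Build _ _ _ _ f f_lin).
have : kermx (lin1_mx fL) != 0.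
  by rewrite kermx_eq0 /row_free neq_ltn (leq_ltn_trans (rank_leq_col _)).
case/rowV0Pn => u /sub_kermxP; rewrite mul_rV_lin1 => fu0 u_neq0.
by exists u.
Qed.

Section PolynomialTriples.
Variable k : fieldType.
Implicit Types x y z : {poly k}.

Lemma size_polyD_le n x y :
  (size x <= n)%N -> (size y <= n)%N -> (size (x + y)%R <= n)%N.
Proof. by move=> ? ?; rewrite (leq_trans (size_polyD _ _)) // geq_max; apply/andP. Qed.

Lemma size_polyM_le m n x y :
  (size x <= m.+1)%N -> (size y <= n.+1)%N -> (size (x * y)%R <= (m + n).+1)%N.
Proof. by move=> ? ?; rewrite (leq_trans (size_polyMleq _ _)) //; lia. Qed.

Lemma size_cofactor_le d n x y :
  size x = d.+1 -> (size (x * y)%R <= (d + n).+1)%N -> (size y <= n.+1)%N.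
Proof.
move=> size_x; have [-> | y_neq0] := eqVneq y 0; first by rewrite size_poly0.
have x_neq0 : x != 0 by rewrite -size_poly_gt0 size_x.
by rewrite size_mul // size_x addSn /= -addnS leq_add2l.
Qed.

Lemma primitive_part x y z : [|| x != 0, y != 0 | z != 0] ->
  exists g x' y' z' : {poly k},
    [/\ g != 0, x = g * x', y = g * y', z = g * z'
      & exists a b c, a * x' + b * y' + c * z' = 1].
Proof.
move=> nz; pose g := gcdp x (gcdp y z).
have g_neq0 : g != 0 by rewrite /g !gcdp_eq0 !negb_and.
have /dvdpP[x' def_x] : g %| x by rewrite dvdp_gcdl.
have /dvdpP[y' def_y] : g %| y by rewrite (dvdp_trans (dvdp_gcdr _ _)) ?dvdp_gcdl.
have /dvdpP[z' def_z] : g %| z by rewrite (dvdp_trans (dvdp_gcdr _ _)) ?dvdp_gcdr.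
have [[u v] /= /eqpf_eq[e1 e1_neq0 uv]] := Bezoutp y z.
have [[s t] /= /eqpf_eq[e2 e2_neq0 st]] := Bezoutp x (gcdp y z).
have {uv} gyz : gcdp y z = e1^-1 *: (u * y + v * z) by rewrite uv scalerK.
exists g, x', y', z'; split; rewrite 1?mulrC //.
exists (e2^-1 *: s), (e2^-1 *: (t * (e1^-1 *: u))), (e2^-1 *: (t * (e1^-1 *: v))).
apply: (mulfI g_neq0); rewrite mulr1.
have def_g : g = e2^-1 *: (s * x + t * (e1^-1 *: (u * y + v * z))).
  by rewrite -gyz st scalerK.
rewrite [RHS]def_g [X in s * X]def_x [X in u * X]def_y [X in v * X]def_z.
by rewrite -!mul_polyC; ring.
Qed.

(** There are [3m + 4] unknown coefficients; [p x + q y + r z] has degree at most [m + d] and gives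
    [m + d + 1] linear equations. *)
Lemma exists_syzygy (d m : nat) x y z :
  (size x <= d.+1)%N -> (size y <= d.+1)%N -> (size z <= d)%N -> (d < m.*2.+3)%N ->
  exists p q r : {poly k},
    [/\ [|| p != 0, q != 0 | r != 0], (size p <= m.+1)%N, (size q <= m.+1)%N,
        (size r <= m.+2)%N & p * x + q * y + r * z = 0].
Proof.
move=> size_x size_y size_z lt_dm.
pose P (u : 'rV[k]_(m.+1 + m.+1 + m.+2)) := rVpoly (lsubmx (lsubmx u)).
pose Q (u : 'rV[k]_(m.+1 + m.+1 + m.+2)) := rVpoly (rsubmx (lsubmx u)).
pose R (u : 'rV[k]_(m.+1 + m.+1 + m.+2)) := rVpoly (rsubmx u).
pose f u : 'rV[k]_(m + d).+1 := poly_rV (P u * x + Q u * y + R u * z).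
have f_lin : linear f.
  move=> e u v; rewrite /f /P /Q /R !linearP /=.
  rewrite -[RHS](linearP (@poly_rV k (m + d).+1)); congr (poly_rV _).
  by rewrite -!mul_polyC; ring.
have [|u u_neq0 fu0] := linear_kernel_neq0 f_lin; first by lia.
exists (P u), (Q u), (R u); split; rewrite ?size_poly //.
- apply: contraNT u_neq0; rewrite !negb_or !negbK => /and3P[/eqP P0 /eqP Q0 /eqP R0].
  by rewrite -[u]hsubmxK -[lsubmx u]hsubmxK -(rVpolyK (lsubmx (lsubmx u)))
    -(rVpolyK (rsubmx (lsubmx u))) -(rVpolyK (rsubmx u)) -/(P u) -/(Q u) -/(R u)
    P0 Q0 R0 !linear0 !row_mx0.
- have size_PQR : (size (P u * x + Q u * y + R u * z)%R <= (m + d).+1)%N.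
    apply: size_polyD_le; first by apply: size_polyD_le; apply: size_polyM_le;
      rewrite ?size_poly.
    case: d size_z {size_x size_y lt_dm f f_lin fu0} => [|d] size_z.
      by move: size_z; rewrite leqn0 size_poly_eq0 => /eqP->; rewrite mulr0 size_poly0.
    by rewrite -addSnnS size_polyM_le ?size_poly.
  by rewrite -(poly_rV_K size_PQR) -/(f u) fu0 linear0.
Qed.
End PolynomialTriples.

(** * Lowering the degree of an isotropic vector *)

Section IsotropicVectors.
Variables (k : fieldType) (A B C D E G : {poly k}).
Hypotheses (size_A : (size A <= 2)%N) (size_B : (size B <= 2)%N)
  (size_C : (size C <= 2)%N) (size_D : (size D <= 3)%N)
  (size_E : (size E <= 3)%N) (size_G : (size G <= 4)%N).
Hypothesis anisotropic : forall x y : {poly k},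
  A * x ^+ 2 + B * (x * y) + C * y ^+ 2 = 0 -> x = 0 /\ y = 0.
Implicit Types x y z : {poly k}.

(** The bound for [z] is one lower because [z] multiplies the vector [W] of degree 1 in [t]; for
    [d = 0] it forces [z = 0]. *)
Definition isotropic_of_degree d x y z :=
  [/\ [|| x != 0, y != 0 | z != 0], qform A B C D E G x y z = 0,
      (size x <= d.+1)%N, (size y <= d.+1)%N & (size z <= d)%N].

Local Ltac size_bound :=
  rewrite ?expr2 ?mulNr ?mulNrn ?mulr2n; repeat (apply: size_polyD_le; rewrite ?size_polyN);
  match goal with size_M : forall e n : nat, _ |- _ =>
    eapply size_M; [eassumption | eassumption | lia] end.

(** The six equations bound [x x'], [y y'] and [x y' + y x'] by degree [2m + 3], the other mixed
    sums by [2m + 2] and [z z'] by [2m + 1]. A coordinate of maximal degree is divided out, first of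
    its own product and then of its two mixed sums. *)
Lemma second_intersection_degree (d m : nat) x y z :
  isotropic_of_degree d x y z -> (exists a b c, a * x + b * y + c * z = 1) ->
  [|| size x == d.+1, size y == d.+1 | (0 < d)%N && (size z == d)] ->
  (d < m.*2.+3)%N ->
  exists x' y' z', isotropic_of_degree (m.*2.+3 - d) x' y' z'.
Proof.
move=> [_ Qv size_x size_y size_z] [a [b [c bezout]]] full lt_dm.
have [p [q [r [pqr_neq0 size_p size_q size_r syz]]]] :=
  exists_syzygy size_x size_y size_z lt_dm.
have [x' [y' [z' [Qv' [[Exx Eyy Ezz] [Exy Exz Eyz]]]]]] :=
  second_intersection Qv bezout syz.
exists x', y', z'.
have size_M e n N (u v : {poly k}) : (size u <= e.+1)%N -> (size v <= n.+1)%N ->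
    (e + n < N)%N -> (size (u * v)%R <= N)%N.
  by move=> size_u size_v; apply: leq_trans; exact: size_polyM_le.
have size_pp (u v : {poly k}) : (size u <= m.+1)%N -> (size v <= m.+1)%N ->
    (size (u * v)%R <= m.*2.+1)%N.
  by move=> ? ?; rewrite -addnn; exact: size_polyM_le.
have size_rp (u : {poly k}) : (size u <= m.+1)%N -> (size (r * u)%R <= m.*2.+2)%N.
  by move=> ?; rewrite -addnn -addSn; exact: size_polyM_le.
have size_rr : (size (r * r)%R <= m.*2.+3)%N.
  by rewrite -addnn -addnS -addSn; exact: size_polyM_le.
have size_rq := size_rp _ size_q; have {}size_rp := size_rp _ size_p.
have size_qq := size_pp _ _ size_q size_q; have size_qp := size_pp _ _ size_q size_p.
have size_pq := size_pp _ _ size_p size_q; have {}size_pp := size_pp _ _ size_p size_p.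
have bound n (u v : {poly k}) : u = v -> (size v <= n)%N -> (size u <= n)%N by move->.
have size_xx : (size (x * x')%R <= m.*2.+4)%N by apply: (bound _ _ _ Exx); size_bound.
have size_yy : (size (y * y')%R <= m.*2.+4)%N by apply: (bound _ _ _ Eyy); size_bound.
have size_zz : (size (z * z')%R <= m.*2.+2)%N by apply: (bound _ _ _ Ezz); size_bound.
have size_xy : (size (x * y' + y * x')%R <= m.*2.+4)%N.
  by apply: (bound _ _ _ Exy); size_bound.
have size_xz : (size (x * z' + z * x')%R <= m.*2.+3)%N.
  by apply: (bound _ _ _ Exz); size_bound.
have size_yz : (size (y * z' + z * y')%R <= m.*2.+3)%N.
  by apply: (bound _ _ _ Eyz); size_bound.
(* If [(x', y', z')] were zero, the equation for [z z'] would make the form vanish at [(q, - p, 0)],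
   so [p = q = 0]; then [x x' = C r^2] with [C] nonzero gives [r = 0]. *)
have nz' : [|| x' != 0, y' != 0 | z' != 0].
  apply: contraTT pqr_neq0; rewrite !negb_or !negbK => /and3P[/eqP x0 /eqP y0 /eqP z0].
  have [p0 q0] : p = 0 /\ q = 0.
    have [|-> /eqP] := @anisotropic q (- p); last by rewrite oppr_eq0 => /eqP.
    by rewrite mulrN sqrrN mulrN -Ezz z0 mulr0.
  have C_neq0 : C != 0.
    apply/eqP => C0; have [|_ /eqP] := @anisotropic 0 1; last by rewrite oner_eq0.
    by rewrite C0; ring.
  have := Exx; rewrite q0 x0 !mulr0 expr0n /= mulr0 addr0 subr0 => /esym/eqP.
  by rewrite mulf_eq0 (negPf C_neq0) expf_eq0 /= p0 eqxx => ->.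
have [n def_n] : exists n, (m.*2.+3 - d = n.+1)%N by exists (m.*2.+2 - d)%N; lia.
have def_m : (m.*2.+2 = d + n)%N by lia.
rewrite def_m in size_xx size_yy size_zz size_xy size_xz size_yz; rewrite {}def_n.
have cofactor (u v w t : {poly k}) e l : (size (u * v + w * t)%R <= (e + l).+1)%N ->
    (size (w * t)%R <= (e + l).+1)%N -> size u = e.+1 -> (size v <= l.+1)%N.
  move=> size_uvwt size_wt size_u; apply: (size_cofactor_le size_u).
  by rewrite -[u * v](addrK (w * t)) size_polyD_le ?size_polyN.
have size_zM (u : {poly k}) : (size u <= n.+2)%N -> (size (z * u)%R <= d + n.+1)%N.
  case: (posnP d) size_z => [-> | d_gt0 size_z].
    by rewrite leqn0 size_poly_eq0 => /eqP-> _; rewrite mul0r size_poly0.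
  by move=> size_u; rewrite -(prednK d_gt0) addSn; apply: size_polyM_le; rewrite ?prednK.
rewrite -!addnS in size_xx size_yy size_xy.
rewrite -addnS in size_xz size_yz.
case/or3P: full => [/eqP sx | /eqP sy | /andP[d_gt0 /eqP sz]].
- have size_x' : (size x' <= n.+2)%N by apply: size_cofactor_le sx _; rewrite -addnS.
  split=> //.
    by apply: cofactor _ _ sx; rewrite -?addnS; [exact: size_xy | rewrite addnS size_polyM_le].
  by apply: cofactor _ _ sx; rewrite -?addnS; [exact: size_xz | exact: size_zM].
- have size_y' : (size y' <= n.+2)%N by apply: size_cofactor_le sy _; rewrite -addnS.
  rewrite addrC in size_xy; split=> //.
    by apply: cofactor _ _ sy; rewrite -?addnS; [exact: size_xy | rewrite addnS size_polyM_le].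
  by apply: cofactor _ _ sy; rewrite -?addnS; [exact: size_yz | exact: size_zM].
- have [e def_d] : exists e, d = e.+1 by exists d.-1; rewrite prednK.
  rewrite def_d in sz size_x size_y size_zz size_xz size_yz.
  rewrite addrC in size_xz; rewrite addrC in size_yz.
  have size_z' : (size z' <= n.+1)%N by apply: size_cofactor_le sz _.
  split=> //.
    apply: cofactor _ _ sz; rewrite -?addSn; first exact: size_xz.
    by rewrite addnS size_polyM_le.
  apply: cofactor _ _ sz; rewrite -?addSn; first exact: size_yz.
  by rewrite addnS size_polyM_le.
Qed.
Lemma isotropic_of_degree_leq d e x y z :
  (d <= e)%N -> isotropic_of_degree d x y z -> isotropic_of_degree e x y z.
Proof.
move=> le_de [nz Q0 size_x size_y size_z]; split=> //; last exact: leq_trans le_de.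
  exact: leq_trans size_x _.
exact: leq_trans size_y _.
Qed.

Lemma primitive_isotropic d x y z : isotropic_of_degree d x y z ->
  exists2 e, (e <= d)%N & exists x' y' z', [/\ isotropic_of_degree e x' y' z',
    exists a b c, a * x' + b * y' + c * z' = 1 &
    [|| size x' == e.+1, size y' == e.+1 | (0 < e)%N && (size z' == e)]].
Proof.
move=> [nz Q0 size_x size_y size_z].
have [g [x' [y' [z' [g_neq0 def_x def_y def_z bezout]]]]] := primitive_part nz.
have nz' : [|| x' != 0, y' != 0 | z' != 0].
  apply: contraTT nz; rewrite !negb_or !negbK => /and3P[/eqP x0 /eqP y0 /eqP z0].
  by rewrite def_x def_y def_z x0 y0 z0 !mulr0 !eqxx.
have size_le (u v : {poly k}) : u = g * v -> (size v <= size u)%N.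
  have [-> | v_neq0 ->] := eqVneq v 0; first by rewrite size_poly0.
  by rewrite dvdp_leq ?mulf_neq0 ?dvdp_mull.
have := leq_trans (size_le _ _ def_x) size_x.
have := leq_trans (size_le _ _ def_y) size_y.
have := leq_trans (size_le _ _ def_z) size_z.
have size_gt0 : (0 < size x' + size y' + size z')%N.
  by move: nz'; rewrite -!size_poly_gt0; lia.
(* [z'] enters with its size, not its degree, because its degree may only reach [e - 1]. *)
exists (maxn (maxn (size x').-1 (size y').-1) (size z')); first by lia.
exists x', y', z'; split; [split | |] => //; try by lia.
apply: (mulfI (expf_neq0 2 g_neq0)); rewrite mulr0 -[RHS]Q0 def_x def_y def_z.
by rewrite /qform; ring.
Qed.

Lemma exists_isotropic_of_degree1 x y z :
  [|| x != 0, y != 0 | z != 0] -> qform A B C D E G x y z = 0 ->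
  exists x' y' z', isotropic_of_degree 1 x' y' z'.
Proof.
move=> nz Q0.
have low e u v w : isotropic_of_degree e u v w -> (e <= 2)%N ->
    exists x' y' z', isotropic_of_degree 1 x' y' z'.
  move=> /primitive_isotropic[f le_fe [x' [y' [z' [iso' bezout full]]]]] le_e2.
  have [le_f1 | lt_1f] := leqP f 1; first by exists x', y', z'; exact: isotropic_of_degree_leq iso'.
  have def_f : f = 2%N by lia.
  rewrite {}def_f in iso' full.
  exact: (@second_intersection_degree 2 0 _ _ _ iso' bezout full isT).
have iso : isotropic_of_degree (size x + size y + size z) x y z by split=> //; lia.
have [e _ [x' [y' [z' [iso' bezout full]]]]] := primitive_isotropic iso.
have [le_e2 | lt_2e] := leqP e 2; first exact: low iso' le_e2.
(* With [m] the integer part of [(e - 1) / 2], the new degree [2m + 3 - e] is 1 for even [e] and 2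
   for odd [e]. *)
have lt_e : (e < ((e.-1)./2).*2.+3)%N by lia.
have [x'' [y'' [z'' iso'']]] := second_intersection_degree iso' bezout full lt_e.
by apply: low iso'' _; lia.
Qed.
End IsotropicVectors.

(** * Cubic forms as trilinear tensors, and their derivatives *)

Section TrilinearForms.
Variables (R : comNzRingType) (n : nat) (c : 'I_n -> 'I_n -> 'I_n -> R).
Implicit Types (u v w : 'rV[R]_n) (a : R).

Definition trilin u v w : R :=
  \sum_i \sum_j \sum_l c i j l * (u 0 i * v 0 j * w 0 l).

Lemma trilinDl u u' v w : trilin (u + u') v w = trilin u v w + trilin u' v w.
Proof. by do 3![rewrite -big_split; apply: eq_bigr => ? _]; rewrite !mxE /=; ring. Qed.

Lemma trilinDm u v v' w : trilin u (v + v') w = trilin u v w + trilin u v' w.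
Proof. by do 3![rewrite -big_split; apply: eq_bigr => ? _]; rewrite !mxE /=; ring. Qed.

Lemma trilinDr u v w w' : trilin u v (w + w') = trilin u v w + trilin u v w'.
Proof. by do 3![rewrite -big_split; apply: eq_bigr => ? _]; rewrite !mxE /=; ring. Qed.

Lemma trilinZl a u v w : trilin (a *: u) v w = a * trilin u v w.
Proof. by do 3![rewrite mulr_sumr; apply: eq_bigr => ? _]; rewrite !mxE /=; ring. Qed.

Lemma trilinZm a u v w : trilin u (a *: v) w = a * trilin u v w.
Proof. by do 3![rewrite mulr_sumr; apply: eq_bigr => ? _]; rewrite !mxE /=; ring. Qed.

Lemma trilinZr a u v w : trilin u v (a *: w) = a * trilin u v w.
Proof. by do 3![rewrite mulr_sumr; apply: eq_bigr => ? _]; rewrite !mxE /=; ring. Qed.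

Definition trilinE := (trilinDl, trilinDm, trilinDr, trilinZl, trilinZm, trilinZr).

Definition dtrilin u v := trilin v u u + trilin u v u + trilin u u v.

End TrilinearForms.

Lemma trilin_map (R S : comNzRingType) (f : {rmorphism R -> S}) (n : nat)
    (c : 'I_n -> 'I_n -> 'I_n -> R) (u v w : 'rV[R]_n) :
  trilin (fun i j l => f (c i j l)) (map_mx f u) (map_mx f v) (map_mx f w)
    = f (trilin c u v w).
Proof. by do 3![rewrite rmorph_sum; apply: eq_bigr => ? _]; rewrite !mxE !rmorphM. Qed.

Section DirectionalDerivative.
Variables (R : comNzRingType) (n : nat) (x w : 'rV[R]_n).
Implicit Types p q : {mpoly R[n]}.

Definition dirderiv p : R := \sum_i w 0 i * p^`M(i).@[x 0].

Lemma dirderivD p q : dirderiv (p + q) = dirderiv p + dirderiv q.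
Proof. by rewrite -big_split; apply: eq_bigr => i _; rewrite mderivD mevalD mulrDr. Qed.

Lemma dirderivZ a p : dirderiv (a *: p) = a * dirderiv p.
Proof.
by rewrite mulr_sumr; apply: eq_bigr => i _; rewrite mderivZ mevalZ mulrCA.
Qed.

Lemma dirderiv0 : dirderiv 0 = 0.
Proof. by rewrite -(scale0r 0) dirderivZ mul0r. Qed.

Lemma dirderiv_sum (I : Type) (r : seq I) (P : pred I) (p : I -> {mpoly R[n]}) :
  dirderiv (\sum_(i <- r | P i) p i) = \sum_(i <- r | P i) dirderiv (p i).
Proof. exact: (big_morph dirderiv dirderivD dirderiv0). Qed.

Lemma dirderivM p q : dirderiv (p * q) = dirderiv p * q.@[x 0] + p.@[x 0] * dirderiv q.
Proof.
rewrite mulr_suml mulr_sumr -big_split; apply: eq_bigr => i _ /=.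
by rewrite mderivM mevalD !mevalM; ring.
Qed.

Lemma dirderivX i : dirderiv 'X_i = w 0 i.
Proof.
rewrite /dirderiv (bigD1 i) //= big1 => [|j ne_ji]; rewrite mderivX mnm1E.
  have -> : (U_(i) - U_(i) = 0 :> 'X_{1..n})%MM by apply/mnmP => j; rewrite mnmBE mnm0E subnn.
  by rewrite eqxx scale1r mpolyX0 meval1 mulr1 addr0.
by rewrite eq_sym (negPf ne_ji) scale0r meval0 mulr0.
Qed.

End DirectionalDerivative.

Lemma mdegS_split (n d : nat) (m : 'X_{1..n}) :
  mdeg m = d.+1 -> exists i m', m = (U_(i) + m')%MM /\ mdeg m' = d.
Proof.
move=> deg_m; have /existsP[i mi_neq0] : [exists i, m i != 0%N].
  apply: contraT => /existsPn m0; suff: mdeg m = 0%N by rewrite deg_m.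
  by rewrite mdegE big1 // => i _; apply/eqP; rewrite -[_ == _]negbK m0.
have le_im : (U_(i) <= m)%MM.
  by apply/mnm_lepP => j; rewrite mnm1E; case: eqP => // <-; rewrite lt0n.
exists i, (m - U_(i))%MM; split; first by rewrite addmC submK.
by apply: succn_inj; rewrite -deg_m -{2}(submK le_im) mdegD mdeg1 addn1.
Qed.

(** Each monomial is entered at one ordered triple of indices; not symmetrising avoids a division by
    6, so every characteristic is allowed. *)
Lemma cubic_tensor (R : comNzRingType) (n : nat) (F : {mpoly R[n]}) : F \is 3.-homog ->
  exists c : 'I_n -> 'I_n -> 'I_n -> R,
    F = \sum_i \sum_j \sum_l c i j l *: ('X_i * 'X_j * 'X_l).
Proof.
move=> /dhomogP F_homog; rewrite [F]mpolyE big_seq.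
elim/big_ind: _ => [|p q [c def_p] [e def_q]|m /F_homog /mdegS_split[i [m1 [-> ]]]].
- exists (fun _ _ _ => 0); rewrite big1 // => i _; rewrite big1 // => j _.
  by rewrite big1 // => l _; rewrite scale0r.
- exists (fun i j l => c i j l + e i j l); rewrite def_p def_q.
  by do 3![rewrite -big_split; apply: eq_bigr => ? _ /=]; rewrite scalerDl.
case/mdegS_split=> j [m2 [-> /eqP/mdeg1P[l /eqP->]]]; set a := F@_ _.
exists (fun i' j' l' => a *+ [&& i' == i, j' == j & l' == l]).
rewrite (bigD1 i) //= [X in _ + X]big1 ?addr0; last first.
  move=> i' /negPf->; rewrite big1 // => j' _; rewrite big1 // => l' _.
  by rewrite scale0r.
rewrite (bigD1 j) //= [X in _ + X]big1 ?addr0; last first.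
  by move=> j' /negPf ne_j; rewrite big1 // => l' _; rewrite ne_j andbF scale0r.
rewrite (bigD1 l) //= [X in _ + X]big1 ?addr0; last first.
  by move=> l' /negPf ne_l; rewrite ne_l !andbF scale0r.
by rewrite !eqxx -mulrA !mpolyXD.
Qed.

Section CubicForm.
Variables (k : fieldType) (n : nat) (F : {mpoly k[n]}) (c : 'I_n -> 'I_n -> 'I_n -> k).
Hypothesis def_F : F = \sum_i \sum_j \sum_l c i j l *: ('X_i * 'X_j * 'X_l).
Variables (R : comNzRingType) (iota : {rmorphism k -> R}).

Let cR i j l := iota (c i j l).

Lemma map_cubicE : map_mpoly iota F =
  \sum_i \sum_j \sum_l cR i j l *: ('X_i * 'X_j * 'X_l).
Proof.
rewrite def_F; do 3![rewrite rmorph_sum; apply: eq_bigr => ? _].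
by rewrite /= map_mpolyZ !rmorphM /= !map_mpolyX.
Qed.

Lemma meval_cubic (x : 'rV[R]_n) : (map_mpoly iota F).@[x 0] = trilin cR x x x.
Proof.
rewrite map_cubicE; do 3![rewrite raddf_sum; apply: eq_bigr => ? _].
by rewrite /= mevalZ !mevalM !mevalXU.
Qed.

Lemma dirderiv_cubic (x w : 'rV[R]_n) :
  dirderiv x w (map_mpoly iota F) = dtrilin cR x w.
Proof.
rewrite map_cubicE /dtrilin -!big_split dirderiv_sum; apply: eq_bigr => i _ /=.
rewrite -!big_split dirderiv_sum; apply: eq_bigr => j _ /=.
rewrite -!big_split dirderiv_sum; apply: eq_bigr => l _ /=.
by rewrite dirderivZ !dirderivM !mevalM !mevalXU !dirderivX; ring.
Qed.

End CubicForm.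

(** * Pencils of binary quadratic forms over [k[t]] *)

Lemma coefM_top (R : nzRingType) (p q : {poly R}) (m n : nat) :
  (size p <= m.+1)%N -> (size q <= n.+1)%N -> (p * q)`_(m + n) = p`_m * q`_n.
Proof.
move=> size_p size_q; have lt_m : (m < (m + n).+1)%N by rewrite ltnS leq_addr.
rewrite coefM (bigD1 (Ordinal lt_m)) //= addKn big1 ?addr0 // => i ne_im.
have [lt_im | lt_mi | eq_im] := ltngtP i m.
- by rewrite [q`__]nth_default ?mulr0 // (leq_trans size_q) //; lia.
- by rewrite nth_default ?mul0r // (leq_trans size_p).
- by rewrite -val_eqE /= eq_im eqxx in ne_im.
Qed.

Lemma irreducible_root (K : fieldType) (p : {poly K}) : irreducible_poly p ->
  exists (K' : fieldType) (iota : {rmorphism K -> K'}) (z : K'), root (map_poly iota p) z.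
Proof.
by case/irredp_FAdjoin=> K' _ [z rz _]; exists K', (in_alg K'), z.
Qed.

Section BinaryQuadraticPencil.
Variables (k : fieldType) (a1 a2 a3 b1 b2 b3 : k).

Definition bquad (R : comNzRingType) (a b c x y : R) : R :=
  a * x ^+ 2 + b * (x * y) + c * y ^+ 2.

Hypothesis no_common_zero : forall (K : fieldType) (iota : {rmorphism k -> K}) (x y : K),
  (x != 0) || (y != 0) -> bquad (iota a1) (iota a2) (iota a3) x y = 0 ->
  bquad (iota b1) (iota b2) (iota b3) x y = 0 -> False.

(** For a primitive vector the equation reads [q = - t p], with [p] and [q] the values of the two
    forms. A root of [p] in an extension would give a common zero, so [p] is constant; then the
    leading coefficients of the vector, its value at infinity, are a common zero over [k]. *)
Lemma bquad_pencil_anisotropic (x y : {poly k}) :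
  bquad ('X * a1%:P + b1%:P) ('X * a2%:P + b2%:P) ('X * a3%:P + b3%:P) x y = 0 ->
  x = 0 /\ y = 0.
Proof.
move=> eq0; have [nz | ] := boolP [|| x != 0, y != 0 | (0 : {poly k}) != 0]; last first.
  by rewrite eqxx orbF negb_or !negbK => /andP[/eqP-> /eqP->].
exfalso; have [g [x' [y' [z' [g_neq0 def_x def_y def_z [u [v [w bezout]]]]]]]] := primitive_part nz.
have z0 : z' = 0 by apply/eqP; move/esym/eqP: def_z; rewrite mulf_eq0 (negPf g_neq0).
rewrite {}z0 mulr0 addr0 in bezout.
pose p := bquad a1%:P a2%:P a3%:P x' y'; pose q := bquad b1%:P b2%:P b3%:P x' y'.
have def_q : q = - 'X * p.
  apply/eqP; rewrite -subr_eq0; apply/eqP; apply: (mulfI (expf_neq0 2 g_neq0)).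
  by rewrite mulr0 -[RHS]eq0 def_x def_y /q /p /bquad; ring.
(* By induction on the size, [h] is replaced by a proper nonconstant divisor until it is irreducible
   and has a root [z] in some extension; by Bezout [x'] and [y'] do not both vanish at [z]. *)
have coprime_pq n (h : {poly k}) : (size h <= n)%N -> (1 < size h)%N -> h %| p -> False.
  elim: n h => [|n IHn] h size_h gt1_h h_dvd.
    by rewrite leqNgt (ltn_trans _ gt1_h) in size_h.
  have [|K [iota [z hz]]] := @irreducible_root k h.
    split=> // d ned1 d_dvd; rewrite -dvdp_size_eqp // eqn_leq dvdp_leq //=; last first.
      by rewrite -size_poly_gt0 (ltn_trans _ gt1_h).
    rewrite leqNgt; apply/negP => lt_dh; apply: (IHn d).
    - by rewrite -ltnS (leq_trans lt_dh).
    - rewrite ltn_neqAle eq_sym ned1 size_poly_gt0; apply: contraTneq d_dvd => ->.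
      by rewrite dvd0p -size_poly_eq0; case: (size h) gt1_h.
    - exact: dvdp_trans h_dvd.
  pose ev (t : {poly k}) := (map_poly iota t).[z].
  have evD (s t : {poly k}) : ev (s + t) = ev s + ev t by rewrite /ev rmorphD hornerD.
  have evM (s t : {poly k}) : ev (s * t) = ev s * ev t by rewrite /ev rmorphM hornerM.
  have evC (a : k) : ev a%:P = iota a by rewrite /ev map_polyC hornerC.
  have ev_p : ev p = 0.
    by case/dvdpP: h_dvd => s ->; rewrite evM [ev h](rootP hz) mulr0.
  apply: (@no_common_zero K iota (ev x') (ev y')).
  - apply: contraTT isT; rewrite negb_or !negbK => /andP[/eqP x0 /eqP y0].
    have := congr1 ev bezout; rewrite evD !evM x0 y0 !mulr0 addr0 evC rmorph1.
    by move/esym/eqP; rewrite oner_eq0.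
  - by rewrite -ev_p /p /bquad !expr2 !evD !evM !evC.
  - by rewrite -[RHS](mulr0 (ev (- 'X))) -ev_p -evM -def_q /q /bquad !expr2 !evD !evM !evC.
have /size1_polyC def_p : (size p <= 1)%N.
  by rewrite leqNgt; apply/negP => gt1_p; apply: (coprime_pq _ p (leqnn _) gt1_p (dvdpp p)).
set e := p`_0 in def_p.
pose n := (maxn (size x') (size y')).-1.
have size_x : (size x' <= n.+1)%N by lia.
have size_y : (size y' <= n.+1)%N by lia.
have top (a b c : k) : (bquad a%:P b%:P c%:P x' y')`_(n + n) = bquad a b c x'`_n y'`_n.
  by rewrite /bquad !expr2 !coefD !coefCM !coefM_top.
have e0 : n = 0%N -> e = 0.
  move=> n0; rewrite n0 in size_x size_y; have : (size q <= 1)%N.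
    by rewrite /q /bquad !expr2 !size_polyD_le // ?(@size_polyM_le _ 0 0) ?size_polyC_leq1 //.
  move/size1_polyC=> size_q; have := congr1 (fun s : {poly k} => s`_1) def_q.
  rewrite size_q coefC /= def_p mulNr coefN coefXM coefC /= => /esym/eqP.
  by rewrite oppr_eq0 => /eqP.
(* The coefficients of degree [2n] of [p = e] and [q = - e t] vanish: for [n > 0] because [2n > 1],
   for [n = 0] because then [e = 0]. *)
apply: (@no_common_zero k idfun x'`_n y'`_n); rewrite /= -?top.
- have nz' : (0 < maxn (size x') (size y'))%N.
    rewrite leq_max !size_poly_gt0; apply: contraT; rewrite negb_or !negbK.
    case/andP=> /eqP x0 /eqP y0; move/esym/eqP: bezout.
    by rewrite x0 y0 !mulr0 addr0 oner_eq0.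
  have lead (s : {poly k}) : size s = n.+1 -> s`_n != 0.
    move=> size_s; rewrite -[n]/(n.+1.-1) -size_s -lead_coefE lead_coef_eq0.
    by rewrite -size_poly_gt0 size_s.
  by case: (leqP (size x') (size y')) => le_xy; apply/orP; [right | left]; apply: lead; lia.
- by rewrite -/p def_p coefC; case: eqP => // n0; apply: e0; lia.
- rewrite -/q def_q def_p mulNr coefN coefXM coefC.
  case: eqP => [_ | n_neq0]; first by rewrite oppr0.
  by case: eqP => [n_eq | _]; rewrite ?oppr0 //; lia.
Qed.
End BinaryQuadraticPencil.

(** * Restriction of a cubic form to lines and planes *)

Lemma row2P (R : Type) (u v : 'rV[R]_2) : u 0 0 = v 0 0 -> u 0 1 = v 0 1 -> u = v.
Proof.
move=> eq0 eq1; apply/rowP => j.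
have [-> // | ->] // : j = 0 \/ j = 1.
by case: j => [[|[|//]] lt_j]; [left | right]; apply: val_inj.
Qed.

Lemma mulmx_row2 (R : comNzRingType) (n : nat) (x : 'rV[R]_2) (L : 'M[R]_(2, n)) :
  x *m L = x 0 0 *: row 0 L + x 0 1 *: row 1 L.
Proof.
rewrite mulmx_sum_row !big_ord_recl big_ord0 addr0.
by have -> : lift ord0 ord0 = 1 :> 'I_2 by apply: val_inj.
Qed.

Section LinesOnCubics.
Variables (R : comNzRingType) (n : nat) (c : 'I_n -> 'I_n -> 'I_n -> R).
Implicit Types u v w : 'rV[R]_n.

(** The coefficients of the binary cubic induced on the line through [u] and [v]; over the field
    with two elements this is stronger than vanishing at its rational points. *)
Definition line_eqs u v : Prop :=
  [/\ trilin c u u u = 0, dtrilin c u v = 0, dtrilin c v u = 0 & trilin c v v v = 0].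

Lemma trilin_line u v a b (x := a *: u + b *: v) :
  trilin c x x x = a ^+ 3 * trilin c u u u + a ^+ 2 * b * dtrilin c u v
    + a * b ^+ 2 * dtrilin c v u + b ^+ 3 * trilin c v v v.
Proof. by rewrite /x /dtrilin !trilinE; ring. Qed.

Lemma line_eqs_trilin u v a b : line_eqs u v ->
  trilin c (a *: u + b *: v) (a *: u + b *: v) (a *: u + b *: v) = 0.
Proof. by case=> e1 e2 e3 e4; rewrite trilin_line e1 e2 e3 e4; ring. Qed.

Lemma line_eqs_dtrilin u v a b a' b' : line_eqs u v ->
  dtrilin c (a *: u + b *: v) (a' *: u + b' *: v) = 0.
Proof.
case=> e1 e2 e3 e4.
have -> : dtrilin c (a *: u + b *: v) (a' *: u + b' *: v) =
   a ^+ 2 * a' *+ 3 * trilin c u u u + (a ^+ 2 * b' + a * a' * b *+ 2) * dtrilin c u v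
   + (a' * b ^+ 2 + a * b * b' *+ 2) * dtrilin c v u + b ^+ 2 * b' *+ 3 * trilin c v v v.
  by rewrite /dtrilin !trilinE; ring.
by rewrite e1 e2 e3 e4; ring.
Qed.

Definition polar u v w :=
  trilin c u v w + trilin c u w v + trilin c v u w + trilin c v w u
  + trilin c w u v + trilin c w v u.

Lemma dtrilin_lin x y u v w : dtrilin c (x *: u + y *: v) w =
  dtrilin c u w * x ^+ 2 + polar u v w * (x * y) + dtrilin c v w * y ^+ 2.
Proof. by rewrite /dtrilin /polar !trilinE; ring. Qed.

Lemma dtrilinDr u v w : dtrilin c u (v + w) = dtrilin c u v + dtrilin c u w.
Proof. by rewrite /dtrilin !trilinE; ring. Qed.

Lemma dtrilinZr a u v : dtrilin c u (a *: v) = a * dtrilin c u v.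
Proof. by rewrite /dtrilin !trilinE; ring. Qed.

(** The terms free of [z] are the restriction to the line through [u] and [v], which is zero;
    dividing the rest by [z] leaves the residual conic. *)
Lemma trilin_plane u v w x y z (s := x *: u + y *: v + z *: w) : line_eqs u v ->
  trilin c s s s =
    z * qform (dtrilin c u w) (polar u v w) (dtrilin c v w)
              (dtrilin c w u) (dtrilin c w v) (trilin c w w w) x y z.
Proof.
move=> uv0; rewrite -[RHS]addr0 -(line_eqs_trilin x y uv0) /s /qform /polar /dtrilin !trilinE.
by ring.
Qed.

End LinesOnCubics.

Section BaseChange.
Variables (R S : comNzRingType) (f : {rmorphism R -> S}) (n : nat).
Variable c : 'I_n -> 'I_n -> 'I_n -> R.
Local Notation fc := (fun i j l => f (c i j l)).
Implicit Types u v w : 'rV[R]_n.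

Lemma dtrilin_map u v : dtrilin fc (map_mx f u) (map_mx f v) = f (dtrilin c u v).
Proof. by rewrite /dtrilin !trilin_map !rmorphD. Qed.

Lemma polar_map u v w :
  polar fc (map_mx f u) (map_mx f v) (map_mx f w) = f (polar c u v w).
Proof. by rewrite /polar !trilin_map !rmorphD. Qed.

Lemma line_eqs_map u v : line_eqs c u v -> line_eqs fc (map_mx f u) (map_mx f v).
Proof.
by case=> e1 e2 e3 e4; split; rewrite ?dtrilin_map ?trilin_map ?e1 ?e2 ?e3 ?e4 rmorph0.
Qed.
End BaseChange.

Section PolynomialPoints.
Variables (k : fieldType) (n : nat) (c : 'I_n -> 'I_n -> 'I_n -> k).
Local Notation cP := (fun i j l => (c i j l)%:P).
Local Notation polyC_mx := (map_mx (@polyC k)).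

(** At the generic point [x] of the line the form is a polynomial in [t] whose four coefficients are
    the four equations. *)
Lemma line_eqs_generic (u v : 'rV[k]_n) (x := 'X *: polyC_mx u + polyC_mx v) :
  trilin cP x x x = 0 -> line_eqs c u v.
Proof.
have := trilin_line cP (polyC_mx u) (polyC_mx v) 'X 1.
rewrite scale1r -/x => -> /=.
rewrite !expr1n !mulr1 !mul1r !dtrilin_map !trilin_map => eq0.
have coef i := congr1 (fun p : {poly k} => p`_i) eq0.
split; [have := coef 3%N | have := coef 2%N | have := coef 1%N | have := coef 0%N];
  by rewrite !coefD !coefMC !coefXn !coefX !coefC /= ?mul0r ?mul1r ?add0r ?addr0.
Qed.

Lemma size_trilin_le (u v w : 'rV[{poly k}]_n) (p q r : nat) :
  (forall i, size (u 0%R i) <= p.+1)%N -> (forall i, size (v 0%R i) <= q.+1)%N ->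
  (forall i, size (w 0%R i) <= r.+1)%N -> (size (trilin cP u v w) <= (p + q + r).+1)%N.
Proof.
move=> size_u size_v size_w.
do 3![apply: (leq_trans (size_sum _ _ _)); apply/bigmax_leqP => ? _].
by rewrite -[(p + q + r)%N]add0n; do !apply: size_polyM_le; rewrite ?size_polyC_leq1.
Qed.
End PolynomialPoints.

(** * Coordinates adapted to the line and its planes *)

Definition const_ratfun (k : fieldType) : {rmorphism k -> {fraction {poly k}}} :=
  GRing.RMorphism.clone k {fraction {poly k}} (@tofrac {poly k} \o @polyC k) _.

(** The square matrices with row blocks [L], [M] and column blocks [U], [N] are mutually inverse:
    [x *m U] and [x *m N] are the coordinates of [x] along [L] and along the complement [M]. *)
Definition coordinates (R : comNzRingType) (L : 'M[R]_(2, 4)) (N : 'M[R]_(4, 2))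
    (M : 'M[R]_(2, 4)) (U : 'M[R]_(4, 2)) : Prop :=
  [/\ L *m N = 0, L *m U = 1%:M, M *m N = 1%:M & U *m L + N *m M = 1%:M].

Lemma coordinates_map (R S : comNzRingType) (f : {rmorphism R -> S}) L N M U :
  coordinates L N M U ->
  coordinates (map_mx f L) (map_mx f N) (map_mx f M) (map_mx f U).
Proof.
case=> LN LU MN ULNM; split; rewrite -!map_mxM -?map_mxD ?LN ?LU ?MN ?ULNM ?map_mx1 //.
by rewrite map_mx0.
Qed.

Lemma coordinates_decomp (R : comNzRingType) (L : 'M[R]_(2, 4)) N M U (x : 'rV[R]_4) :
  coordinates L N M U -> x = (x *m U) *m L + (x *m N) *m M.
Proof. by case=> _ _ _ ULNM; rewrite -!mulmxA -mulmxDr ULNM mulmx1. Qed.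

Lemma coordinates_line (K : fieldType) (L : 'M[K]_(2, 4)) N M U (x : 'rV[K]_4) :
  coordinates L N M U -> (x <= L)%MS <-> x *m N = 0.
Proof.
move=> LNMU; split=> [/submxP[p ->] | xN0].
  by case: LNMU => LN _ _ _; rewrite -mulmxA LN mulmx0.
by rewrite (coordinates_decomp x LNMU) xN0 mul0mx addr0 submxMl.
Qed.

(** [M] is a left inverse of [N]. The rows of [1 - N M] are killed by [N], hence by dimension lie in
    the row space of [L], and [U] expresses them there. *)
Lemma pencil_coordinates (k : fieldType) (L : 'M[k]_(2, 4)) (N : 'M[k]_(4, 2)) :
  is_line L -> is_pencil L N -> exists M U, coordinates L N M U.
Proof.
move=> rank_L [rank_N LN0].
have /row_fullP[M MN1] : row_full N by rewrite /row_full rank_N.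
have /row_freeP[B LB1] : row_free L by rewrite /row_free rank_L.
have kerN : (kermx N <= L)%MS.
  suff /eqmxP[_ ->] : (L == kermx N)%MS by [].
  rewrite -mxrank_leqif_eq; last by apply/sub_kermxP.
  by rewrite mxrank_ker rank_L rank_N.
have /submxP[U def_U] : (1%:M - N *m M <= L)%MS.
  apply: submx_trans kerN; apply/sub_kermxP.
  by rewrite mulmxBl mul1mx -mulmxA MN1 mulmx1 subrr.
have ULNM : U *m L + N *m M = 1%:M by rewrite -def_U subrK.
exists M, U; split=> //.
have LUL : L *m U *m L = L.
  by rewrite -mulmxA -def_U mulmxBr mulmx1 mulmxA LN0 mul0mx subr0.
by rewrite -[L *m U]mulmx1 -LB1 mulmxA LUL.
Qed.

(** * Planes of the pencil and the ideal of the line *)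

Section PlaneForms.
Variables (K : fieldType) (N : 'M[K]_(4, 2)).
Implicit Types (t : 'rV[K]_2) (x w : 'rV[K]_4).

Lemma meval_pencil_form j x : (pencil_form N j).@[x 0] = (x *m N) 0 j.
Proof.
by rewrite /pencil_form raddf_sum mxE; apply: eq_bigr => i _; rewrite /= mevalZ mevalXU mulrC.
Qed.

Lemma meval_plane_form t x :
  (plane_form N t).@[x 0] = t 0 0 * (x *m N) 0 1 - t 0 1 * (x *m N) 0 0.
Proof. by rewrite /plane_form mevalB !mevalZ !meval_pencil_form. Qed.

Lemma dirderiv_pencil_form j x w : dirderiv x w (pencil_form N j) = (w *m N) 0 j.
Proof.
rewrite /pencil_form dirderiv_sum mxE; apply: eq_bigr => i _.
by rewrite dirderivZ dirderivX mulrC.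
Qed.

Lemma dirderiv_plane_form t x w :
  dirderiv x w (plane_form N t) = t 0 0 * (w *m N) 0 1 - t 0 1 * (w *m N) 0 0.
Proof.
by rewrite /plane_form -scaleNr dirderivD !dirderivZ !dirderiv_pencil_form mulNr.
Qed.

Lemma pencil_form_homog j : pencil_form N j \is 1.-homog.
Proof.
by apply: rpred_sum => i _; apply: rpredZ; rewrite dhomogX /= mdeg1.
Qed.
End PlaneForms.

Lemma meval_map (R S T : comNzRingType) (f : {rmorphism R -> S}) (g : {rmorphism S -> T})
    (h : {rmorphism R -> T}) (n : nat) (p : {mpoly R[n]}) (v : 'I_n -> S) :
  h =1 g \o f -> (map_mpoly h p).@[g \o v] = g (map_mpoly f p).@[v].
Proof.
move=> def_h; elim/mpolyind: p => [|a m p _ _ IHp]; first by rewrite !(rmorph0, meval0).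
rewrite !(rmorphD, mevalD) /= {}IHp !map_mpolyZ !map_mpolyX !mevalZ !mevalX rmorphM def_h.
rewrite rmorph_prod; congr (_ * _ + _); apply: eq_bigr => i _.
by rewrite rmorphXn.
Qed.

Section TrilinearHomogeneity.
Variables (K : fieldType) (n d1 d2 d3 : nat).
Lemma trilin_homog (c : 'I_n -> 'I_n -> 'I_n -> K) (u v w : 'rV[{mpoly K[n]}]_n) :
  (forall i, u 0 i \is d1.-homog) -> (forall i, v 0 i \is d2.-homog) ->
  (forall i, w 0 i \is d3.-homog) ->
  trilin (fun i j l => (c i j l)%:MP) u v w \is (d1 + d2 + d3).-homog.
Proof.
move=> hu hv hw; apply: rpred_sum => i _; apply: rpred_sum => j _; apply: rpred_sum => l _.
by rewrite mul_mpolyC; apply: rpredZ; do !apply: dhomogM.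
Qed.
End TrilinearHomogeneity.

(** With [d = x - p], the difference of the values at [x] and [p] telescopes into
    [T(d, x, x) + T(p, d, x) + T(p, p, d)]. *)
Lemma trilin_pencil (R : comNzRingType) n (c : 'I_n -> 'I_n -> 'I_n -> R)
    (x p m0 m1 : 'rV[R]_n) (l0 l1 : R) :
  x = p + (l0 *: m0 + l1 *: m1) -> trilin c p p p = 0 ->
  trilin c x x x = l0 * (trilin c m0 x x + trilin c p m0 x + trilin c p p m0)
                 + l1 * (trilin c m1 x x + trilin c p m1 x + trilin c p p m1).
Proof. by move=> -> p0; rewrite -[RHS]addr0 -p0 !trilinE; ring. Qed.

(** The generic point [X] of the space is compared with its projection [P] to [L] along [M]: the
    form vanishes at [P], and [X - P] has the two pencil forms as coordinates. *)
Lemma cubic_through_line (K : fieldType) (F : {mpoly K[4]}) c L N M U :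
  F = \sum_i \sum_j \sum_l c i j l *: ('X_i * 'X_j * 'X_l) ->
  coordinates L N M U -> line_eqs c (row 0 L) (row 1 L) ->
  exists G : 'I_2 -> {mpoly K[4]}, (forall j, G j \is 2.-homog) /\
    F = pencil_form N 0 * G 0 + pencil_form N 1 * G 1.
Proof.
move=> def_F LNMU L_F.
pose cst := @mpolyC 4 K; pose cM i j l := cst (c i j l).
have coord := coordinates_map cst LNMU.
pose X : 'rV[{mpoly K[4]}]_4 := \row_i 'X_i.
pose P := (X *m map_mx cst U) *m map_mx cst L.
pose Mj j := row j (map_mx cst M).
have FX : F = trilin cM X X X.
  rewrite def_F; do 3![apply: eq_bigr => ? _].
  by rewrite /cM /cst !mxE mul_mpolyC.
have XN j : (X *m map_mx cst N) 0 j = pencil_form N j.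
  rewrite /pencil_form mxE; apply: eq_bigr => i _.
  by rewrite !mxE mulrC mul_mpolyC.
have def_X : X = P + (pencil_form N 0 *: Mj 0 + pencil_form N 1 *: Mj 1).
  by rewrite [LHS](coordinates_decomp X coord) [X in _ + X]mulmx_row2 !XN.
have P0 : trilin cM P P P = 0.
  rewrite /P mulmx_row2; apply: line_eqs_trilin; rewrite -!map_row.
  exact: (line_eqs_map cst L_F).
exists (fun j => trilin cM (Mj j) X X + trilin cM P (Mj j) X + trilin cM P P (Mj j)).
split=> [j | ].
  have homX i : X 0 i \is 1.-homog by rewrite mxE dhomogX /= mdeg1.
  have homM i : Mj j 0 i \is 0.-homog.
    by rewrite !mxE /cst -[M j i]mulr1 mpolyCM -/1 mul_mpolyC; apply: rpredZ; exact: dhomog1.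
  have homP i : P 0 i \is 1.-homog.
    rewrite mxE; apply: rpred_sum => j' _; rewrite [map_mx _ _ _ _]mxE mulrC mul_mpolyC.
    apply: rpredZ; rewrite mxE; apply: rpred_sum => l _.
    by rewrite [map_mx _ _ _ _]mxE mulrC mul_mpolyC rpredZ.
  by rewrite !rpredD //; [apply: (@trilin_homog K 4 0 1 1) | apply: (@trilin_homog K 4 1 0 1)
    | apply: (@trilin_homog K 4 1 1 0)].
by rewrite FX; exact: trilin_pencil def_X P0.
Qed.

(** * Inclusion of lines in the surface, and the fibration off [L] *)

Section SurfaceWithLine.
Variables (k : fieldType) (F : {mpoly k[4]}) (c : 'I_4 -> 'I_4 -> 'I_4 -> k).
Hypothesis def_F : F = \sum_i \sum_j \sum_l c i j l *: ('X_i * 'X_j * 'X_l).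

(** The inclusion is tested at the generic point of [L], over the extension [k(t)]. *)
Lemma line_eqs_surface (L : 'M[k]_(2, 4)) :
  line_in_surface L F -> line_eqs c (row 0 L) (row 1 L).
Proof.
move=> L_F; apply: line_eqs_generic.
pose T : 'rV[{poly k}]_2 := \row_j 'X^(j == 0).
have -> : 'X *: map_mx polyC (row 0 L) + map_mx polyC (row 1 L) = T *m map_mx polyC L.
  by rewrite mulmx_row2 !mxE /= scale1r !map_row.
set x := T *m _.
pose fr : {rmorphism {poly k} -> {fraction {poly k}}} := @tofrac {poly k}.
have x_L : (map_mx fr x <= map_mx (const_ratfun k) L)%MS.
  suff -> : map_mx (const_ratfun k) L = map_mx fr (map_mx polyC L) by rewrite map_mxM submxMl.
  by rewrite -map_mx_comp.
have := L_F _ (const_ratfun k) _ x_L; rewrite /on_surface (meval_cubic def_F).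
have := trilin_map fr (fun i j l => (c i j l)%:P) x x x => /= ->.
by move/eqP; rewrite tofrac_eq0 => /eqP.
Qed.

Lemma surface_line_eqs (L : 'M[k]_(2, 4)) :
  line_eqs c (row 0 L) (row 1 L) -> line_in_surface L F.
Proof.
move=> L_c K iota x /submxP[p ->]; rewrite /on_surface (meval_cubic def_F) mulmx_row2.
by apply: line_eqs_trilin; rewrite -!map_row; exact: line_eqs_map.
Qed.

Variables (L : 'M[k]_(2, 4)) (N : 'M[k]_(4, 2)) (M : 'M[k]_(2, 4)) (U : 'M[k]_(4, 2)).
Hypotheses (coord : coordinates L N M U) (L_F : line_eqs c (row 0 L) (row 1 L)).

Lemma pencil_line_locus (y : 'rV[k]_4) :
  (y <= L)%MS <-> (pencil_form N 0).@[y 0] = 0 /\ (pencil_form N 1).@[y 0] = 0.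
Proof.
rewrite !meval_pencil_form; apply: iff_trans (coordinates_line _ coord) _.
split=> [-> | [y0 y1]]; first by rewrite !mxE.
by apply: row2P; rewrite [RHS]mxE.
Qed.

(** Modulo the equation of the plane through [x] the two pencil forms are proportional, so
    [F = l0 G0 + l1 G1] becomes [m q] with [m] linear. Since [m] is nonzero at [x], the conic [q]
    vanishes there. *)
Lemma off_line_fibration_graph (x : 'rV[k]_4) :
  x *m N != 0 -> on_surface F x -> fibration_graph F L N x (x *m N).
Proof.
move=> xN_neq0 Fx; have [G [G_homog defFG]] := cubic_through_line def_F coord L_F.
set t := x *m N; have x_neq0 : x != 0 by apply: contraNneq xN_neq0 => ->; rewrite mul0mx.
have lx : (plane_form N t).@[x 0] = 0 by rewrite meval_plane_form mulrC subrr.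
split=> //; split=> //.
have on_q m q r : m.@[x 0] != 0 -> F = m * q + plane_form N t * r -> q.@[x 0] = 0.
  move=> mx_neq0 defF; move: Fx; rewrite /on_surface defF mevalD !mevalM lx mul0r addr0.
  by move/eqP; rewrite mulf_eq0 (negPf mx_neq0) => /eqP.
(* [m] is [l1] if [t 0 0 = 0] and [l0] otherwise, so that with the plane it cuts out exactly [L]. *)
have [t0 | t0_neq0] := eqVneq (t 0 0) 0.
  have t1_neq0 : t 0 1 != 0.
    by apply: contraNneq xN_neq0 => t1; apply/eqP/row2P; rewrite [RHS]mxE.
  have defF : F = pencil_form N 1 * G 1 + plane_form N t * (- (t 0 1)^-1 *: G 0).
    rewrite {1}defFG /plane_form t0 scale0r sub0r mulNr -scalerAl -scalerAr scaleNr scalerN.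
    by rewrite scalerA mulfV // scale1r opprK addrC.
  exists (G 1); last by apply: on_q defF; rewrite meval_pencil_form.
  split=> //; exists (pencil_form N 1), (- (t 0 1)^-1 *: G 0).
  split=> //; rewrite ?rpredZ ?pencil_form_homog // => y.
  rewrite pencil_line_locus meval_plane_form t0 mul0r sub0r -(meval_pencil_form N _ y).
  split=> [[-> ->] | [/eqP l0 ->]]; first by rewrite mulr0 oppr0.
  by move: l0; rewrite oppr_eq0 mulf_eq0 (negPf t1_neq0) => /eqP.
have defF : F = pencil_form N 0 * (G 0 + (t 0 1 / t 0 0) *: G 1)
              + plane_form N t * ((t 0 0)^-1 *: G 1).
  rewrite {1}defFG /plane_form mulrBl mulrDr -!scalerAl -!scalerAr !scalerA mulfV // scale1r.
  by rewrite -addrA; congr (_ + _); rewrite addrC subrK.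
exists (G 0 + (t 0 1 / t 0 0) *: G 1); last by apply: on_q defF; rewrite meval_pencil_form.
split; first by rewrite rpredD ?rpredZ.
exists (pencil_form N 0), ((t 0 0)^-1 *: G 1).
split=> //; rewrite ?rpredZ ?pencil_form_homog // => y.
rewrite pencil_line_locus meval_plane_form -!(meval_pencil_form N _ y).
split=> [[-> ->] | [/eqP l0 m0]]; first by rewrite !mulr0 subrr.
by move: l0; rewrite m0 mulr0 subr0 mulf_eq0 (negPf t0_neq0) => /eqP.
Qed.

End SurfaceWithLine.

(** * From a skew line to a section *)

Section SectionsAndSkewLines.
Variables (k : fieldType) (F : {mpoly k[4]}) (c : 'I_4 -> 'I_4 -> 'I_4 -> k).
Hypothesis def_F : F = \sum_i \sum_j \sum_l c i j l *: ('X_i * 'X_j * 'X_l).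
Variables (L : 'M[k]_(2, 4)) (N : 'M[k]_(4, 2)) (M : 'M[k]_(2, 4)) (U : 'M[k]_(4, 2)).
Hypotheses (coord : coordinates L N M U) (L_F : line_eqs c (row 0 L) (row 1 L)).

(** Skewness makes the pencil coordinates an isomorphism on [L']. In the basis [V] of [L'] with
    [V N = 1], the map [s(t) = t V] has pencil coordinates [t]. *)
Lemma skew_line_is_section (L' : 'M[k]_(2, 4)) : is_line L' ->
  line_in_surface L' F -> ~ lines_meet L L' -> line_is_section F L N L'.
Proof.
move=> rank_L' L'_F skew.
have unit_LN : L' *m N \in unitmx.
  rewrite -row_free_unit -kermx_eq0; apply/negP => /negP/rowV0Pn[p /sub_kermxP pLN0 p_neq0].
  apply: skew; exists k, idfun, (p *m L'); rewrite !map_mx_id ?submxMl //.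
  split=> //; last by apply/(coordinates_line _ coord); rewrite -mulmxA.
  apply: contraNneq p_neq0 => pL0; apply/eqP; apply: (row_free_inj (_ : row_free L')).
    by rewrite /row_free rank_L'.
  by rewrite pL0 mul0mx.
pose V := invmx (L' *m N) *m L'.
have VN : V *m N = 1%:M by rewrite -mulmxA mulVmx.
pose s i : {mpoly k[2]} := \sum_j V j i *: 'X_j.
have eval_s (K : fieldType) (iota : {rmorphism k -> K}) (t : 'rV[K]_2) :
    eval_map (base_change iota s) t = t *m map_mx iota V.
  apply/rowP => i; rewrite mxE [RHS]mxE /base_change /s.
  rewrite (rmorph_sum (map_mpoly iota)) (raddf_sum (meval (t 0))); apply: eq_bigr => j _ /=.
  by rewrite map_mpolyZ map_mpolyX mevalZ mevalXU [map_mx _ _ _ _]mxE mulrC.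
have evalN (K : fieldType) (iota : {rmorphism k -> K}) (t : 'rV[K]_2) :
    t *m map_mx iota V *m map_mx iota N = t.
  by rewrite -mulmxA -map_mxM VN map_mx1 mulmx1.
have eval_L' (K : fieldType) (iota : {rmorphism k -> K}) (t : 'rV[K]_2) :
    (t *m map_mx iota V <= map_mx iota L')%MS.
  by rewrite map_mxM mulmxA submxMl.
have eval_F (K : fieldType) (iota : {rmorphism k -> K}) (t : 'rV[K]_2) :
  on_surface (map_mpoly iota F) (t *m map_mx iota V) by exact: L'_F.
have eval_neq0 (K : fieldType) (iota : {rmorphism k -> K}) (t : 'rV[K]_2) :
    t != 0 -> t *m map_mx iota V != 0.
  by apply: contraNneq => tV0; rewrite -(evalN _ iota t) tV0 mul0mx.
exists s; first split; first split.
- exists 1%N => i; apply: rpred_sum => j _; apply: rpredZ.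
  by rewrite dhomogX /= mdeg1.
- by move=> K iota t t_neq0; rewrite eval_s; split; [exact: eval_neq0 | exact: eval_F].
- move=> K iota t t_neq0; rewrite eval_s.
  rewrite -[X in fibration_graph _ _ _ _ X](evalN _ iota t).
  apply: (off_line_fibration_graph (map_cubicE def_F iota) (coordinates_map iota coord)).
  + by rewrite -!map_row; exact: line_eqs_map.
  + by rewrite evalN.
  + exact: eval_F.
move=> K iota x x_neq0; split=> [/submxP[p def_x] | [t t_neq0]].
  have L'V : L' = L' *m N *m V by rewrite /V mulmxA mulmxV // mul1mx.
  have def_x' : x = (x *m map_mx iota N) *m map_mx iota V.
    by rewrite def_x -!mulmxA -!map_mxM mulmxA -L'V.
  exists (x *m map_mx iota N); last by rewrite eval_s -def_x' submx_refl.
  by apply: contraNneq x_neq0 => xN0; rewrite def_x' xN0 mul0mx.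
by rewrite eval_s => /andP[le_x _]; exact: submx_trans le_x (eval_L' _ _ _).
Qed.
End SectionsAndSkewLines.

(** * From a section to a skew line *)

(** Product rule for [F = m q + l r]: at [x] the forms [l], [m], [q] vanish, and [l] has derivative
    zero along [w]. This exploits the residual conic at points of [L]. *)
Lemma residual_conic_dirderiv (K : fieldType) (F : {mpoly K[4]}) (L : 'M[K]_(2, 4))
    (N : 'M[K]_(4, 2)) (t : 'rV[K]_2) (x w : 'rV[K]_4) (q : {mpoly K[4]}) :
  (x <= L)%MS -> w *m N = t -> is_residual_conic F L (plane_form N t) q ->
  q.@[x 0] = 0 -> dirderiv x w F = 0.
Proof.
move=> x_L wN [_ [m [r [_ _ locus ->]]]] qx; have [lx mx] := (locus x).1 x_L.
by rewrite dirderivD !dirderivM qx mx lx dirderiv_plane_form wN; ring.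
Qed.

Section SectionToSkewLine.
Variables (k : fieldType) (F : {mpoly k[4]}) (c : 'I_4 -> 'I_4 -> 'I_4 -> k).
Hypothesis def_F : F = \sum_i \sum_j \sum_l c i j l *: ('X_i * 'X_j * 'X_l).
Variables (L : 'M[k]_(2, 4)) (N : 'M[k]_(4, 2)) (M : 'M[k]_(2, 4)) (U : 'M[k]_(4, 2)).
Hypotheses (coord : coordinates L N M U) (L_F : line_eqs c (row 0 L) (row 1 L)).
Hypothesis F_smooth : smooth_surface F.

(** On [L] the derivatives along [L] vanish since [L] lies on the surface; with those along both
    rows of [M] all partial derivatives would vanish. *)
Lemma smooth_along_line (K : fieldType) (iota : {rmorphism k -> K}) (p : 'rV[K]_2)
    (cK := fun i j l => iota (c i j l)) (x := p *m map_mx iota L) :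
  p != 0 -> dtrilin cK x (map_mx iota (row 0 M)) = 0 ->
  dtrilin cK x (map_mx iota (row 1 M)) = 0 -> False.
Proof.
move=> p_neq0 dM0 dM1; have coordK := coordinates_map iota coord.
have L_FK := line_eqs_map iota L_F.
have x_neq0 : x != 0.
  case: coordK => _ LU _ _; apply: contraNneq p_neq0 => x0.
  by rewrite -[p]mulmx1 -LU mulmxA -/x x0 mul0mx.
have def_x : x = p 0 0 *: map_mx iota (row 0 L) + p 0 1 *: map_mx iota (row 1 L).
  by rewrite /x mulmx_row2 -!map_row.
have x_F : on_surface (map_mpoly iota F) x.
  by rewrite /on_surface (meval_cubic def_F) def_x; exact: line_eqs_trilin.
have dL a b : dtrilin cK x (a *: map_mx iota (row 0 L) + b *: map_mx iota (row 1 L)) = 0.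
  by rewrite def_x; exact: line_eqs_dtrilin.
have [i /eqP] := F_smooth x_neq0 x_F; apply.
have := dirderiv_cubic def_F iota x (delta_mx 0 i).
rewrite [X in dtrilin _ _ X](coordinates_decomp _ coordK) !mulmx_row2 -!map_row -/cK.
rewrite dtrilinDr dL dtrilinDr !dtrilinZr dM0 dM1.
rewrite !mulr0 !addr0 => <-.
rewrite /dirderiv (bigD1 i) //= mxE !eqxx mul1r big1 ?addr0 // => j /negPf ne_ji.
by rewrite mxE ne_ji andbF mul0r.
Qed.

Local Notation polyC_mx := (map_mx (@polyC k)).
Let cP i j l := (c i j l)%:P.
Let L0 := polyC_mx (row 0 L).
Let L1 := polyC_mx (row 1 L).
Let W := 'X *: polyC_mx (row 0 M) + polyC_mx (row 1 M).

(* The points of the plane of parameter (t : 1) are s = x L0 + y L1 + z W, and F(s) is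
   z times this form, which therefore defines the residual conic. *)
Let Q := qform (dtrilin cP L0 W) (polar cP L0 L1 W) (dtrilin cP L1 W)
               (dtrilin cP W L0) (dtrilin cP W L1) (trilin cP W W W).

(** This is the derivative of [F] at [x L0 + y L1] along [W], a pencil in [t] of binary quadratic
    forms; a common zero over an extension would be a singular point on [L]. *)
Lemma conic_anisotropic_on_line (x y : {poly k}) :
  dtrilin cP L0 W * x ^+ 2 + polar cP L0 L1 W * (x * y) + dtrilin cP L1 W * y ^+ 2 = 0 ->
  x = 0 /\ y = 0.
Proof.
pose a0 j := dtrilin c (row 0 L) (row j M); pose a1 j := polar c (row 0 L) (row 1 L) (row j M).
pose a2 j := dtrilin c (row 1 L) (row j M).
have -> : dtrilin cP L0 W = 'X * (a0 0)%:P + (a0 1)%:P.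
  by rewrite /W dtrilinDr dtrilinZr /L0 !dtrilin_map.
have -> : dtrilin cP L1 W = 'X * (a2 0)%:P + (a2 1)%:P.
  by rewrite /W dtrilinDr dtrilinZr /L1 !dtrilin_map.
have -> : polar cP L0 L1 W = 'X * (a1 0)%:P + (a1 1)%:P.
  by rewrite /a1 -!polar_map -/L0 -/L1 /W /polar !trilinE; ring.
apply: bquad_pencil_anisotropic => K iota {}x {}y nz eq0 eq1.
pose p : 'rV[K]_2 := \row_j (if j == 0 then x else y).
apply: (@smooth_along_line K iota p); rewrite ?mulmx_row2 -?map_row ?dtrilin_lin ?mxE /=.
- apply: contraTneq nz => p0; rewrite negb_or !negbK.
  have := congr1 (fun q : 'rV_2 => q 0 0) p0; have := congr1 (fun q : 'rV_2 => q 0 1) p0.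
  by rewrite !mxE /= => -> ->; rewrite eqxx.
- by rewrite !dtrilin_map polar_map.
- by rewrite !dtrilin_map polar_map.
Qed.

Let T : 'rV[{poly k}]_2 := \row_j 'X^(j == 0).

Lemma generic_plane_point : W = T *m polyC_mx M.
Proof. by rewrite mulmx_row2 !mxE /= scale1r -!map_row. Qed.

(** The value of the section at the generic parameter [(t : 1)] lies in the plane of that parameter,
    so it is [x L0 + y L1 + z W], where [F = z Q] vanishes. *)
Lemma section_isotropic (s : 'I_4 -> {mpoly k[2]}) : is_section F L N s ->
  exists x y z, [|| x != 0, y != 0 | z != 0] /\ Q x y z = 0.
Proof.
move=> [_ sect]; pose iota := const_ratfun k.
pose fr : {rmorphism {poly k} -> {fraction {poly k}}} := @tofrac {poly k}.
pose t : 'rV[{fraction {poly k}}]_2 := map_mx fr T.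
pose sg : 'rV[{poly k}]_4 := \row_i (map_mpoly polyC (s i)).@[T 0].
have t0E : t 0 0 = fr 'X by rewrite !mxE.
have t1E : t 0 1 = 1 by rewrite !mxE /= /fr tofrac1.
have t_neq0 : t != 0.
  by apply/eqP => t0; have := t1E; rewrite t0 mxE => /esym/eqP; rewrite oner_eq0.
have [] := sect _ iota t t_neq0; set S := eval_map _ _.
have def_S : S = map_mx fr sg.
  apply/rowP => i; rewrite !mxE -(@meval_map _ _ _ polyC fr iota) //.
  by apply: meval_eq => j; rewrite /t /= mxE.
move=> S_neq0 _ F_S [plane_S [q residual q_S]].
have coordP := coordinates_map polyC coord; have coordK := coordinates_map iota coord.
pose x := (sg *m polyC_mx U) 0 0; pose y := (sg *m polyC_mx U) 0 1.
pose z := (sg *m polyC_mx N) 0 1.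
have S_N : S *m map_mx iota N = map_mx fr (sg *m polyC_mx N).
  by rewrite def_S map_mxM -map_mx_comp.
have sgN : sg *m polyC_mx N = z *: T.
  have : fr ((sg *m polyC_mx N) 0 0) = fr (z * 'X).
    have ev j : map_mx fr (sg *m polyC_mx N) 0 j = fr ((sg *m polyC_mx N) 0 j).
      by rewrite mxE.
    move/eqP: plane_S; rewrite meval_plane_form S_N t0E t1E mul1r !ev subr_eq0 => /eqP <-.
    by rewrite mulrC -rmorphM.
  move/eqP; rewrite tofrac_eq => /eqP sgN0.
  by apply: row2P; rewrite [RHS]mxE [T _ _]mxE ?mulr1.
have def_sg : sg = x *: L0 + y *: L1 + z *: W.
  rewrite [LHS](coordinates_decomp _ coordP) sgN -scalemxAl -generic_plane_point.
  by rewrite mulmx_row2 -!map_row.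
exists x, y, z; split.
  apply: contraNT S_neq0; rewrite !negb_or !negbK => /and3P[/eqP x0 /eqP y0 /eqP z0].
  by rewrite def_S def_sg x0 y0 z0 !scale0r !addr0 map_mx0.
have L_P := line_eqs_map polyC L_F.
have trilin_fr u v w : trilin (fun i j l => iota (c i j l)) (map_mx fr u) (map_mx fr v)
    (map_mx fr w) = fr (trilin cP u v w) := trilin_map fr cP u v w.
have sg_F : trilin cP sg sg sg = 0.
  apply/eqP; rewrite -tofrac_eq0 -/fr -trilin_fr -def_S.
  by move: F_S; rewrite /on_surface (meval_cubic def_F) => ->.
have /eqP := sg_F; rewrite def_sg trilin_plane // mulf_eq0 -/Q => /orP[/eqP z0 | /eqP //].
(* For [z = 0] the generic point of the section lies on [L] and [F = z Q] says nothing. Then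
   [Q x y 0] is the derivative of [F] along [W], zero because the point is on the residual conic. *)
have S_L : (S <= map_mx iota L)%MS.
  by apply/(coordinates_line _ coordK); rewrite S_N sgN z0 scale0r map_mx0.
have W_N : map_mx fr W *m map_mx iota N = t.
  rewrite generic_plane_point map_mxM -map_mx_comp -mulmxA -map_mxM.
  by case: coord => _ _ -> _; rewrite map_mx1 mulmx1.
have dS := residual_conic_dirderiv S_L W_N residual q_S.
have : dtrilin cP sg W = 0.
  apply/eqP; rewrite -tofrac_eq0 -/fr -(dtrilin_map fr) -def_S.
  by move: dS; rewrite (dirderiv_cubic def_F) => ->.
rewrite def_sg z0 scale0r addr0 dtrilin_lin /Q /qform => eq0.
by rewrite eq0; ring.
Qed.

(** The point [x L0 + y L1 + z W] has degree at most 1 in [t] and runs over a line. As [z] is a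
    nonzero constant, the pencil coordinates are invertible on it, so it has rank 2 and misses
    [L]. *)
Lemma isotropic_skew_line (x y z : {poly k}) :
  [|| x != 0, y != 0 | z != 0] -> Q x y z = 0 ->
  (size x <= 2)%N -> (size y <= 2)%N -> (size z <= 1)%N ->
  exists L' : 'M[k]_(2, 4), [/\ is_line L', line_in_surface L' F & ~ lines_meet L L'].
Proof.
move=> nz Q0 size_x size_y /size1_polyC; set a := z`_0 => def_z.
have a_neq0 : a != 0.
  apply: contraTneq nz => a0; have z0 : z = 0 by rewrite def_z a0.
  have [|-> ->] := @conic_anisotropic_on_line x y; last by rewrite z0 !eqxx.
  by move: Q0; rewrite z0 /Q /qform !mulr0 expr0n /= !mulr0 !addr0.
(* Row 0 holds the coefficients of [t] and row 1 the constant terms, so that [(t, 1) V = (x, y)]. *)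
pose V : 'M[k]_2 := \matrix_(i, j) (if j == 0 then x else y)`_(i == 0).
pose L' := V *m L + a *: M.
have L'N : L' *m N = a%:M.
  by case: coord => LN _ MN _; rewrite mulmxDl -mulmxA LN mulmx0 add0r -scalemxAl MN scalemx1.
exists L'; split.
- apply/eqP/row_freeP; exists (a^-1 *: N).
  by rewrite -scalemxAr L'N scale_scalar_mx mulVf.
- apply: (surface_line_eqs def_F); apply: line_eqs_generic.
  have -> : 'X *: polyC_mx (row 0 L') + polyC_mx (row 1 L') = x *: L0 + y *: L1 + z *: W.
    have TE (A : 'M[k]_(2, 4)) : 'X *: polyC_mx (row 0 A) + polyC_mx (row 1 A) = T *m polyC_mx A.
      by rewrite mulmx_row2 !mxE /= scale1r -!map_row.
    rewrite TE map_mxD map_mxM map_mxZ mulmxDr mulmxA -scalemxAr -TE -/W /= -def_z.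
    have poly2 (p : {poly k}) : (size p <= 2)%N -> p = 'X * (p`_1)%:P + (p`_0)%:P.
      move=> size_p; apply/polyP => i; rewrite coefD coefXM !coefC.
      by case: i => [|[|i]] /=; rewrite ?add0r ?addr0 // nth_default // (leq_trans size_p).
    have -> : T *m polyC_mx V = \row_j (if j == 0 then x else y).
      by apply: row2P; rewrite mulmx_row2 !mxE /= mul1r -poly2.
    by rewrite mulmx_row2 !mxE /= -!map_row.
  transitivity (z * Q x y z); last by rewrite Q0 mulr0.
  exact: (trilin_plane W x y z (line_eqs_map polyC L_F)).
case=> K [iota [u [u_neq0 u_L u_L']]]; have coordK := coordinates_map iota coord.
move/eqP: u_neq0; apply; case/submxP: u_L' => p def_u.
have := (coordinates_line u coordK).1 u_L; rewrite def_u -mulmxA -map_mxM L'N.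
rewrite map_scalar_mx mul_mx_scalar => /eqP; rewrite scaler_eq0 fmorph_eq0 (negPf a_neq0) /=.
by move=> /eqP->; rewrite mul0mx.
Qed.

Lemma section_skew_line (s : 'I_4 -> {mpoly k[2]}) : is_section F L N s ->
  exists L' : 'M[k]_(2, 4), [/\ is_line L', line_in_surface L' F & ~ lines_meet L L'].
Proof.
move=> /section_isotropic[x [y [z [nz Q0]]]].
(* [L0] and [L1] have degree 0 and [W] has degree 1, so a coefficient of [Q] has degree at most the
   number of its arguments [W]. *)
pose deg_le (u : 'rV[{poly k}]_4) n := forall i, (size (u 0%R i) <= n.+1)%N.
have deg_cst u : deg_le (polyC_mx u) 0%N by move=> i; rewrite mxE size_polyC_leq1.
have deg_W : deg_le W 1%N.
  move=> i; rewrite mxE; apply: size_polyD_le; last exact: leq_trans (deg_cst _ i) _.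
  by rewrite mxE; apply: (@size_polyM_le _ 1 0); [rewrite size_polyX | exact: deg_cst].
have size_T u v w p q r n : deg_le u p -> deg_le v q -> deg_le w r -> (p + q + r < n)%N ->
    (size (trilin cP u v w) <= n)%N.
  by move=> du dv dw; apply: leq_trans; exact: size_trilin_le.
have size_dT u v p q n : deg_le u p -> deg_le v q -> (p + p + q < n)%N ->
    (size (dtrilin cP u v) <= n)%N.
  move=> du dv lt_n; apply: size_polyD_le; [apply: size_polyD_le |].
  - by apply: (size_T _ _ _ _ _ _ _ dv du du); lia.
  - by apply: (size_T _ _ _ _ _ _ _ du dv du); lia.
  - exact: (size_T _ _ _ _ _ _ _ du du dv).
have size_B : (size (polar cP L0 L1 W) <= 2)%N.
  rewrite /polar; do !apply: size_polyD_le.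
  - exact: size_T (deg_cst _) (deg_cst _) deg_W _.
  - exact: size_T (deg_cst _) deg_W (deg_cst _) _.
  - exact: size_T (deg_cst _) (deg_cst _) deg_W _.
  - exact: size_T (deg_cst _) deg_W (deg_cst _) _.
  - exact: size_T deg_W (deg_cst _) (deg_cst _) _.
  - exact: size_T deg_W (deg_cst _) (deg_cst _) _.
have size_A : (size (dtrilin cP L0 W) <= 2)%N by exact: size_dT (deg_cst _) deg_W _.
have size_C : (size (dtrilin cP L1 W) <= 2)%N by exact: size_dT (deg_cst _) deg_W _.
have size_D : (size (dtrilin cP W L0) <= 3)%N by exact: size_dT deg_W (deg_cst _) _.
have size_E : (size (dtrilin cP W L1) <= 3)%N by exact: size_dT deg_W (deg_cst _) _.
have size_G : (size (trilin cP W W W) <= 4)%N by exact: (size_T _ _ _ _ _ _ _ deg_W deg_W deg_W).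
have [x' [y' [z' [nz' Q0' size_x size_y size_z]]]] := exists_isotropic_of_degree1
  size_A size_B size_C size_D size_E size_G conic_anisotropic_on_line nz Q0.
exact: isotropic_skew_line nz' Q0' size_x size_y size_z.
Qed.
End SectionToSkewLine.

Theorem mainTheorem2 (k : fieldType) (F : {mpoly k[4]})
    (L : 'M[k]_(2, 4)) (N : 'M[k]_(4, 2))
    (F_cubic : is_cubic_form F) (F_smooth : smooth_surface F)
    (L_line : is_line L) (L_in_X : line_in_surface L F)
    (N_pencil : is_pencil L N) :
  ((exists s : 'I_4 -> {mpoly k[2]}, is_section F L N s) <->
   (exists L' : 'M[k]_(2, 4),
      [/\ is_line L', line_in_surface L' F & ~ lines_meet L L']))
  /\
  (forall L' : 'M[k]_(2, 4),
      is_line L' -> line_in_surface L' F -> ~ lines_meet L L' ->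
      line_is_section F L N L').
Proof.
have [_ F_homog] := F_cubic; have [c def_F] := cubic_tensor F_homog.
have [M [U coord]] := pencil_coordinates L_line N_pencil.
have L_F := line_eqs_surface def_F L_in_X.
split; last exact: (skew_line_is_section def_F coord L_F).
split=> [[s s_sect] | [L' [L'_line L'_F skew]]].
  exact: (section_skew_line def_F coord L_F F_smooth s_sect).
by have [s s_sect _] := skew_line_is_section def_F coord L_F L'_line L'_F skew; exists s.
Qed.
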